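(* For every constant $\delta>0$ there exists a constant $C=C(\delta)>0$ such that the following holds. For every sufficiently large $d\in\mathbb{N}$, there exist infinitely many $n$ for which there exists an $(n,d,\lambda)$-graph $G$ with $\frac{\lambda}{d}\le\delta$ whose longest induced path is of length at most $\frac{Cn}{d}$.
   Context: Graphs are finite and simple. Given a $d$-regular graph $G$ on $n$ vertices, let $d=\lambda_1\ge \lambda_2\ge\cdots\ge\lambda_n$ be the eigenvalues of its adjacency matrix (with multiplicity) and let $\lambda=\max\{|\lambda_2|,|\lambda_n|\}$; then $G$ is called an $(n,d,\lambda)$-graph. An induced path of $G$ is an induced subgraph of $G$ that is a path. ''Sufficiently large $d$'' means $d\ge d_1$ for some $d_1$ depending only on $\delta$. *)

(* Defs.v *)
From HB Require Import structures.
From mathcomp Require Import all_boot all_order all_algebra.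
From mathcomp Require Import boolp classical_sets cardinality reals.

Set Implicit Arguments.
Unset Strict Implicit.
Unset Printing Implicit Defensive.

Import Order.TTheory GRing.Theory Num.Theory.

Record sgraph := SGraph {
  vertex :> finType;
  edge : rel vertex;
  edge_sym : symmetric edge;
  edge_irr : irreflexive edge
}.

Definition graph_iso (G H : sgraph) : Prop :=
  exists f : G -> H, bijective f /\ forall x y : G, edge (f x) (f y) = edge x y.

Section Induced.
Variables (G : sgraph) (S : {set G}).

Definition induced_edge : rel {x : G | x \in S} :=
  fun x y => edge (val x) (val y).

Lemma induced_edge_sym : symmetric induced_edge.
Proof. by move=> x y; rewrite /induced_edge edge_sym. Qed.

Lemma induced_edge_irr : irreflexive induced_edge.
Proof. by move=> x; rewrite /induced_edge edge_irr. Qed.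

Definition induced : sgraph := SGraph induced_edge_sym induced_edge_irr.
End Induced.

Section PathGraph.
Variable l : nat.

Definition path_edge : rel 'I_l.+1 :=
  fun i j => (i.+1 == j :> nat) || (j.+1 == i :> nat).

Lemma path_edge_sym : symmetric path_edge.
Proof. by move=> i j; rewrite /path_edge orbC. Qed.

Lemma path_edge_irr : irreflexive path_edge.
Proof. by move=> i; rewrite /path_edge orbb gtn_eqF. Qed.

(* The path with l edges, hence l.+1 vertices: length counts edges. *)
Definition path_graph : sgraph := SGraph path_edge_sym path_edge_irr.
End PathGraph.

Definition has_induced_path (G : sgraph) (l : nat) : Prop :=
  exists S : {set G}, graph_iso (path_graph l) (induced S).

Definition longest_induced_path_length (G : sgraph) (l : nat) : Prop :=
  has_induced_path G l /\ forall m : nat, has_induced_path G m -> m <= l.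

Definition regular (G : sgraph) (d : nat) : Prop :=
  forall x : G, #|[set y : G | edge x y]%SET| = d.

Local Open Scope ring_scope.

Definition adjacency (R : realType) (G : sgraph) : 'M[R]_#|G| :=
  \matrix_(i, j) (edge (enum_val i) (enum_val j))%:R.

(* s lists the eigenvalues of A with multiplicity, in nonincreasing order. *)
Definition spectrum (R : realType) (n : nat) (A : 'M[R]_n) (s : seq R) : Prop :=
  sorted >=%R s /\ char_poly A = \prod_(a <- s) ('X - a%:P).

(* Eigenvalues are numbered from 0 in s, so the second largest one is s`_1 and
   the smallest one is s`_n.-1. *)
Definition ndl_graph (R : realType) (n d : nat) (lambda : R) (G : sgraph) :
    Prop :=
  [/\ #|G| = n, regular G d &
      exists2 s : seq R, spectrum (adjacency R G) s &
        lambda = Num.max `|s`_1| `|s`_n.-1|].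

(* Main.v *)
Require Import Defs.
From HB Require Import structures.
From mathcomp Require Import all_boot all_order all_algebra.
From mathcomp Require Import boolp classical_sets cardinality reals.
From mathcomp Require Import all_field complex.
From mathcomp Require Import ring lra zify.

(** Start from expanders [L] of a fixed degree [d0] on arbitrarily many vertices,
    whose ratio of second eigenvalue to degree is as small as desired, and blow
    up: replace each vertex by a blob of [m] vertices and each edge by a complete
    bipartite graph.  This multiplies degree and eigenvalues by [m], hence keeps
    the ratio.  But an induced path cannot meet a blob three times, unless it
    lies inside it ([blob_path_bound]): a vertex of the path adjacent to one
    member of the blob would be adjacent to all three.  So the length of an
    induced path is at most twice the number [n / m] of blobs, while [m] is at
    least a constant times [d].  To reach every large degree [d], and not only
    multiples of a constant, an [r]-regular graph with bounded [r] is added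
    inside each blob; this changes the eigenvalues by at most [r]
    ([blowup_gap]).

    The expanders come from the zig-zag product ([zigzag_contracts]).  Affine
    planes over finite fields have [q ^ 2] vertices, degree [q] and eigenvalues
    of size [sqrt q] ([plane_norm2]); from them one obtains a small graph with
    [D ^ 4] vertices and degree [D] ([fourth_power_expander]), and the iteration
    of squaring and zig-zag product with this graph gives graphs of degree
    [D ^ 2] with arbitrarily many vertices and ratio of order of the ratio of
    the small graph ([expander_family]).  These have loops and multiple edges.
    The multiple edges are spread out over further affine planes
    ([simple_lift]), and the loops are discarded in the blow-up.

    All spectral estimates are stated for functions of sum zero, as a
    contraction bound or equivalently as a bound on the bilinear form.  Only at
    the end is this translated into eigenvalues: conjugating by a unitriangular
    matrix splits off the eigenvalue [d] of the constant vector, and each root of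
    the remaining characteristic polynomial is real and has an eigenvector of
    sum zero ([spectrum_deflate]). *)

Set Implicit Arguments.
Unset Strict Implicit.
Unset Printing Implicit Defensive.

Import Order.TTheory GRing.Theory Num.Theory.

Local Open Scope ring_scope.

(** * Contractions on functions of sum zero *)

Section InnerProduct.
Variables (R : realType) (V : finType).
Implicit Types f g h : V -> R.

Definition dot f g : R := \sum_v f v * g v.
Definition norm2 f : R := dot f f.

Lemma norm2_ge0 f : 0 <= norm2 f.
Proof. by apply: sumr_ge0 => v _; rewrite -expr2 sqr_ge0. Qed.

Lemma eq_dot f f' g g' : f =1 f' -> g =1 g' -> dot f g = dot f' g'.
Proof. by move=> ef eg; apply: eq_bigr => v _; rewrite ef eg. Qed.

Lemma eq_norm2 f f' : f =1 f' -> norm2 f = norm2 f'.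
Proof. by move=> ef; apply: eq_dot. Qed.

Lemma dotDl f f' g : dot (fun v => f v + f' v) g = dot f g + dot f' g.
Proof. by rewrite -big_split; apply: eq_bigr => v _; rewrite mulrDl. Qed.

Lemma dotDr f g g' : dot f (fun v => g v + g' v) = dot f g + dot f g'.
Proof. by rewrite -big_split; apply: eq_bigr => v _; rewrite mulrDr. Qed.

Lemma dotZl a f g : dot (fun v => a * f v) g = a * dot f g.
Proof. by rewrite mulr_sumr; apply: eq_bigr => v _; rewrite mulrA. Qed.

Lemma dotZr a f g : dot f (fun v => a * g v) = a * dot f g.
Proof. by rewrite mulr_sumr; apply: eq_bigr => v _; rewrite mulrCA. Qed.

Lemma norm2Z a f : norm2 (fun v => a * f v) = a ^+ 2 * norm2 f.
Proof. by rewrite /norm2 dotZl dotZr mulrA. Qed.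

Lemma dotC f g : dot f g = dot g f.
Proof. by apply: eq_bigr => v _; rewrite mulrC. Qed.

Lemma norm2D f g :
  norm2 (fun v => f v + g v) = norm2 f + norm2 g + 2 * dot f g.
Proof. by rewrite /norm2 dotDl !dotDr (dotC g f); ring. Qed.

(** The square of [f - g / c] is nonnegative.  Bounding inner products by a
    weighted sum of squared norms, rather than by a product of norms, keeps
    every later estimate linear, so that bounds on blocks simply add up. *)
Lemma young c f g : 0 < c -> 2 * dot f g <= c * norm2 f + c^-1 * norm2 g.
Proof.
move=> c0; rewrite -subr_ge0.
have -> : c * norm2 f + c^-1 * norm2 g - 2 * dot f g =
          c * norm2 (fun v => f v + - c^-1 * g v).
  by rewrite (norm2D f (fun v => - c^-1 * g v)) norm2Z dotZr; field; rewrite gt_eqF.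
by rewrite mulr_ge0 ?norm2_ge0 // ltW.
Qed.

Lemma young1 f g : 2 * dot f g <= norm2 f + norm2 g.
Proof. by have := young f g ltr01; rewrite invr1 !mul1r. Qed.

(** Cauchy-Schwarz against the constant function. *)
Lemma sqr_sum_le f : (\sum_v f v) ^+ 2 <= #|V|%:R * norm2 f.
Proof.
have [V0|V0] := posnP #|V|.
  rewrite big1 ?expr0n ?V0 ?mul0r // => v.
  by have := fintype0 v V0.
set s := \sum_v f v.
have n0 : 0 < #|V|%:R :> R by rewrite ltr0n.
have := norm2_ge0 (fun v => f v + - (s / #|V|%:R) * 1).
rewrite /norm2 dotDl !dotDr !dotZl !dotZr -/(norm2 f).
have -> : dot f (fun=> 1) = s by apply: eq_bigr => v _; rewrite mulr1.
have -> : dot (fun=> 1) f = s by apply: eq_bigr => v _; rewrite mul1r.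
have -> : dot (fun=> 1) (fun=> 1) = #|V|%:R.
  by rewrite /dot mulr1 sumr_const.
have -> : norm2 f + - (s / #|V|%:R) * s +
   (- (s / #|V|%:R) * s + - (s / #|V|%:R) * (- (s / #|V|%:R) * #|V|%:R)) =
   (#|V|%:R * norm2 f - s ^+ 2) / #|V|%:R by field; rewrite gt_eqF.
by rewrite pmulr_lge0 ?invr_gt0 // subr_ge0.
Qed.

(** For the adjacency operator of a regular graph, [contracts T c] says that
    every eigenvalue off the constant functions is at most [c] in absolute
    value. *)
Definition contracts (T : (V -> R) -> V -> R) (c : R) :=
  forall f, \sum_v f v = 0 -> norm2 (T f) <= c ^+ 2 * norm2 f.

(** Together with [dot_contracts], this makes a contraction bound and a bound on
    the bilinear form the same thing.  Squaring a graph is natural for the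
    former, products and blow-ups are natural for the latter. *)
Lemma contracts_dot T c f g : 0 < c -> contracts T c -> \sum_v g v = 0 ->
  2 * dot f (T g) <= c * (norm2 f + norm2 g).
Proof.
move=> c0 Tc g0; apply: (le_trans (young f (T g) c0)).
rewrite mulrDr lerD2l mulrC ler_pdivrMr //.
by apply: (le_trans (Tc _ g0)); rewrite expr2 -!mulrA [c * norm2 g]mulrC.
Qed.

Lemma dot_contracts T c : 0 < c ->
  (forall f, \sum_v f v = 0 -> \sum_v T f v = 0) ->
  (forall f g, \sum_v f v = 0 -> \sum_v g v = 0 ->
     2 * dot f (T g) <= c * (norm2 f + norm2 g)) ->
  contracts T c.
Proof.
move=> c0 T0 Tc f f0.
(* [T f / c] is the function against which the form detects [norm2 (T f)]. *)
have := Tc (fun v => c^-1 * T f v) f.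
rewrite dotZl norm2Z -/(norm2 (T f)) -mulr_sumr T0 // mulr0.
move=> /(_ erefl f0).
set a := norm2 (T f); set b := norm2 f.
have -> : c * (c^-1 ^+ 2 * a + b) = c^-1 * (a + c ^+ 2 * b).
  by field; rewrite gt_eqF.
rewrite mulrCA ler_pM2l ?invr_gt0 //; lra.
Qed.

End InnerProduct.

(** * Rotation maps *)

Section RotationMaps.
Variable R : realType.

Section Walk.
Variables (V K : finType) (rot : V * K -> V * K).
Hypothesis rotK : involutive rot.

Definition walk (f : V -> R) (v : V) : R := \sum_k f (rot (v, k)).1.

Lemma dot_walkE f g : dot f (walk g) = \sum_x f x.1 * g (rot x).1.
Proof.
rewrite /dot; under eq_bigr do rewrite mulr_sumr.
by rewrite pair_bigA; apply: eq_bigr => -[].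
Qed.

(** The adjacency operator is self-adjoint because the rotation map is an
    involution. *)
Lemma dot_walk f g : dot f (walk g) = dot (walk f) g.
Proof.
rewrite dot_walkE (reindex_inj (inv_inj rotK)) /=.
under eq_bigr do rewrite rotK mulrC.
by rewrite -dot_walkE; apply: eq_bigr => v _; rewrite mulrC.
Qed.

Lemma sum_walk f : \sum_v walk f v = #|K|%:R * \sum_v f v.
Proof.
have := dot_walk (fun=> 1) f; rewrite /dot.
under eq_bigr do rewrite mul1r.
move=> ->; rewrite mulr_sumr; apply: eq_bigr => v _.
by rewrite /walk sumr_const.
Qed.

Lemma walk_cst c v : walk (fun=> c) v = #|K|%:R * c.
Proof. by rewrite /walk sumr_const mulr_natl. Qed.

End Walk.

(** A regular multigraph given by its rotation map: [rot (v, k) = (w, l)] when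
    the edge leaving [v] with label [k] arrives at [w], where it carries the
    label [l].  The labels are what makes a zig-zag product definable, and
    involutivity is the symmetry of the graph.  The number [e] bounds the
    second largest eigenvalue in absolute value, relative to the degree. *)
Definition expander (V K : finType) (e : R) :=
  exists2 rot : V * K -> V * K, involutive rot &
    contracts (walk rot) (e * #|K|%:R).

Lemma expander_le (V K : finType) (e e' : R) :
  0 <= e -> e <= e' -> expander V K e -> expander V K e'.
Proof.
move=> e0 ee' [rot rotK rote]; exists rot => // f f0.
apply: (le_trans (rote f f0)); apply: ler_wpM2r; first exact: norm2_ge0.
have e'0 := le_trans e0 ee'.
by rewrite ler_pXn2r ?nnegrE ?mulr_ge0 ?ler0n // ler_wpM2r ?ler0n.
Qed.

Lemma bij_of_card (T T' : finType) : #|T| = #|T'| ->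
  exists (f : T -> T') (g : T' -> T), cancel f g /\ cancel g f.
Proof.
move=> e.
exists (fun x => enum_val (cast_ord e (enum_rank x))).
exists (fun x => enum_val (cast_ord (esym e) (enum_rank x))).
by split=> x; rewrite enum_valK ?cast_ordK ?cast_ordKV enum_rankK.
Qed.

Lemma expander_card (V V' K K' : finType) (e : R) :
  #|V| = #|V'| -> #|K| = #|K'| -> expander V K e -> expander V' K' e.
Proof.
move=> /bij_of_card[a [a' [aK a'K]]] eK; have := eK.
move=> /bij_of_card[b [b' [bK b'K]]] [rot rotK rote].
pose rot' (x : V' * K') : V' * K' :=
  let y := rot (a' x.1, b' x.2) in (a y.1, b y.2).
have E f v : walk rot' f (a v) = walk rot (f \o a) v.
  rewrite /walk (reindex b) /=; last by apply: onW_bij; exists b'.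
  by apply: eq_bigr => k _; rewrite aK bK.
have rei (h : V' -> R) : \sum_v h v = \sum_v h (a v).
  by rewrite (reindex a) //; apply: onW_bij; exists a'.
exists rot' => [[v k]|f f0].
  by rewrite /rot' /= aK bK -surjective_pairing rotK /= a'K b'K.
rewrite /norm2 /dot rei [\sum_v f v * _]rei -eK.
under eq_bigr do rewrite E.
apply: (rote (f \o a)).
by have := f0; rewrite rei.
Qed.

(** Two steps of a walk.  The label with which a pair of steps arrives lists
    the two return labels in reverse order, as the way back retraces the second
    step first. *)
Lemma expander_square (V K : finType) (e : R) :
  expander V K e -> expander V (K * K)%type (e ^+ 2).
Proof.
move=> [rot rotK rote].
exists (fun x : V * (K * K) => let w := rot (x.1, x.2.1) in
  let y := rot (w.1, x.2.2) in (y.1, (y.2, w.2))).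
  move=> [v [i j]] /=.
  set w := rot (v, i); set y := rot (w.1, j).
  by rewrite -!surjective_pairing rotK /= -surjective_pairing rotK.
move=> f f0.
set T := walk _.
have -> : norm2 (T f) = norm2 (walk rot (walk rot f)).
  apply: eq_norm2 => v; rewrite /T /walk pair_bigA.
  by apply: eq_bigr => -[].
apply: (le_trans (rote _ _)).
  by rewrite (sum_walk rotK) f0 mulr0.
rewrite card_prod natrM.
apply: (@le_trans _ _ ((e * #|K|%:R) ^+ 2 * ((e * #|K|%:R) ^+ 2 * norm2 f))).
  by apply: ler_wpM2l; [exact: sqr_ge0 | exact: rote].
rewrite le_eqVlt; apply/orP; left; apply/eqP; ring.
Qed.

End RotationMaps.

(** * The zig-zag product *)

Section ZigZag.
Variables (R : realType) (V K E : finType).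
Variables (rotG : V * K -> V * K) (rotH : K * E -> K * E).
Hypotheses (rotGK : involutive rotG) (rotHK : involutive rotH).
Implicit Types f g : V * K -> R.

(** Every vertex [v] of the large graph becomes a cloud [{v} * K], on which the
    small graph [rotH] lives.  An edge of the product is a small step, then the
    large edge named by the current label, then a small step. *)
Definition zigzag (x : (V * K) * (E * E)) : (V * K) * (E * E) :=
  let a := rotH (x.1.2, x.2.1) in
  let b := rotG (x.1.1, a.1) in
  let c := rotH (b.2, x.2.2) in
  ((b.1, c.1), (c.2, a.2)).

Lemma zigzagK : involutive zigzag.
Proof.
move=> [[v k] [i j]]; rewrite /zigzag /=.
set a := rotH (k, i); set b := rotG (v, a.1); set c := rotH (b.2, j).
rewrite -surjective_pairing rotHK /= -surjective_pairing rotGK /=.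
by rewrite -surjective_pairing rotHK.
Qed.

Definition cloud_walk f (x : V * K) : R := walk rotH (fun k => f (x.1, k)) x.2.
Definition cloud_sum f (v : V) : R := \sum_k f (v, k).
Definition cloud_mean f (x : V * K) : R := #|K|%:R^-1 * cloud_sum f x.1.
Definition cloud_rest f (x : V * K) : R := f x - cloud_mean f x.

Lemma walk_zigzag f :
  walk zigzag f =1 cloud_walk (fun x => cloud_walk f (rotG x)).
Proof.
move=> [v k]; rewrite /cloud_walk /walk /= pair_bigA /=.
by apply: eq_bigr => -[i j].
Qed.

Lemma dot_cloud f g : dot f g = \sum_v dot (fun k => f (v, k)) (fun k => g (v, k)).
Proof. by rewrite /dot pair_bigA; apply: eq_bigr => -[]. Qed.

Lemma dot_cloud_walk f g : dot f (cloud_walk g) = dot (cloud_walk f) g.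
Proof. by rewrite !dot_cloud; apply: eq_bigr => v _; exact: dot_walk. Qed.

Lemma sum_cloud f : \sum_x f x = \sum_v cloud_sum f v.
Proof. by rewrite pair_bigA; apply: eq_bigr => -[]. Qed.

Hypothesis K_gt0 : (0 < #|K|)%N.
Let k0 : #|K|%:R != 0 :> R. Proof. by rewrite pnatr_eq0 -lt0n. Qed.

Lemma sum_cloud_rest f v : \sum_k cloud_rest f (v, k) = 0.
Proof.
rewrite /cloud_rest /cloud_mean /= big_split sumrN sumr_const /=.
by rewrite -[X in - X]mulr_natl mulVKf // subrr.
Qed.

Lemma norm2_cloud_mean f :
  norm2 (cloud_mean f) = #|K|%:R^-1 * norm2 (cloud_sum f).
Proof.
rewrite /norm2 dot_cloud mulr_sumr; apply: eq_bigr => v _.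
by rewrite /dot /cloud_mean /= sumr_const -[LHS]mulr_natl; field.
Qed.

Lemma norm2_cloud f : norm2 f = norm2 (cloud_mean f) + norm2 (cloud_rest f).
Proof.
have -> : norm2 f = norm2 (fun x => cloud_mean f x + cloud_rest f x).
  by apply: eq_norm2 => x; rewrite /cloud_rest addrC subrK.
have mr0 : dot (cloud_mean f) (cloud_rest f) = 0.
  rewrite dotC dot_cloud big1 // => v _.
  by rewrite /dot /cloud_mean /= -mulr_suml sum_cloud_rest mul0r.
by rewrite [LHS](norm2D (cloud_mean f) (cloud_rest f)) mr0 mulr0 addr0.
Qed.

Lemma cloud_walk_split f x :
  cloud_walk f x = #|E|%:R * cloud_mean f x + cloud_walk (cloud_rest f) x.
Proof.
rewrite /cloud_walk -[#|E|%:R * _](walk_cst rotH _ x.2) /walk -big_split /=.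
by apply: eq_bigr => i _; rewrite /cloud_rest /cloud_mean addrC subrK.
Qed.

(** Split a function into its means over the clouds and the rest, which sums to
    zero on each cloud.  A small step keeps the means and shrinks the rest by
    the factor [a]; on the means, the large step acts as the walk of [rotG] and
    contributes [e].  The two mixed terms contribute [a] together, because the
    squared norms of the means and of the rests add up, and the rest against
    the rest contributes [a ^+ 2]. *)
Lemma zigzag_contracts (e a : R) : (0 < #|E|)%N -> 0 < e -> 0 < a ->
  contracts (walk rotG : (V -> R) -> _) (e * #|K|%:R) ->
  contracts (walk rotH : (K -> R) -> _) (a * #|E|%:R) ->
  contracts (walk zigzag : (V * K -> R) -> _)
    ((e + a + a ^+ 2) * #|{: E * E}|%:R).
Proof.
move=> E_gt0 e0 a0 HG HH.
have E0 : 0 < #|E|%:R :> R by rewrite ltr0n.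
have n0 : 0 < #|K|%:R :> R by rewrite ltr0n.
have rest_le f : norm2 (cloud_walk (cloud_rest f)) <=
    (a * #|E|%:R) ^+ 2 * norm2 (cloud_rest f).
  rewrite /norm2 !dot_cloud mulr_sumr; apply: ler_sum => v _.
  exact/HH/sum_cloud_rest.
have normP f : norm2 (fun x => f (rotG x)) = norm2 f.
  by rewrite {2}/norm2 /dot (reindex_inj (inv_inj rotGK)).
(* On means, the large step is the walk of [rotG] up to scaling. *)
have mean_le f g : \sum_x f x = 0 -> \sum_x g x = 0 ->
    2 * dot (cloud_mean f) (fun x => cloud_mean g (rotG x)) <=
    e * (norm2 (cloud_mean f) + norm2 (cloud_mean g)).
  rewrite !sum_cloud => f0 g0.
  have -> : dot (cloud_mean f) (fun x => cloud_mean g (rotG x)) =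
      #|K|%:R ^- 2 * dot (cloud_sum f) (walk rotG (cloud_sum g)).
    rewrite dot_walkE mulr_sumr; apply: eq_bigr => x _.
    by rewrite /cloud_mean expr2 invfM; ring.
  have H := contracts_dot (cloud_sum f) (mulr_gt0 e0 n0) HG g0.
  rewrite !norm2_cloud_mean.
  have -> : 2 * (#|K|%:R ^- 2 * dot (cloud_sum f) (walk rotG (cloud_sum g))) =
     #|K|%:R ^- 2 * (2 * dot (cloud_sum f) (walk rotG (cloud_sum g))) by ring.
  apply: (le_trans (ler_wpM2l _ H)); first by rewrite invr_ge0 sqr_ge0.
  rewrite le_eqVlt; apply/orP; left; apply/eqP; field; exact: k0.
rewrite card_prod natrM.
apply: dot_contracts => [|f f0|f g f0 g0].
- by rewrite !mulr_gt0 // !addr_gt0 ?exprn_gt0.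
- by rewrite (sum_walk zigzagK) f0 mulr0.
have -> : dot f (walk zigzag g) = dot (cloud_walk f) (fun x => cloud_walk g (rotG x)).
  by rewrite -dot_cloud_walk; apply: eq_dot => //; exact: walk_zigzag.
set q := #|E|%:R in E0 rest_le *.
set fm := cloud_mean f; set fr := cloud_walk (cloud_rest f).
set gm := fun x => cloud_mean g (rotG x).
set gr := fun x => cloud_walk (cloud_rest g) (rotG x).
have -> : dot (cloud_walk f) (fun x => cloud_walk g (rotG x)) =
   q ^+ 2 * dot fm gm + q * dot fm gr + q * dot fr gm + dot fr gr.
  have -> : dot (cloud_walk f) (fun x => cloud_walk g (rotG x)) =
      dot (fun x => q * fm x + fr x) (fun x => q * gm x + gr x).
    by apply: eq_dot => x; exact: cloud_walk_split.
  by rewrite dotDl !dotDr !dotZl !dotZr; ring.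
have H1 := mean_le f g f0 g0.
have c0 : 0 < a * q by rewrite mulr_gt0.
have H2 := young fm gr c0.
have c1 : 0 < (a * q)^-1 by rewrite invr_gt0.
(* The weight is inverted here since the shrunk function now comes first. *)
have H3 := young fr gm c1; rewrite invrK in H3.
have H4 := young1 fr gr.
have Hf := rest_le f; have Hg := rest_le g.
have Nf := norm2_cloud f; have Ng := norm2_cloud g.
rewrite (normP (cloud_mean g)) in H3.
rewrite (normP (cloud_walk (cloud_rest g))) in H2 H4.
rewrite -/fr in Hf H3 H4; rewrite -/fm in H1 H2 Nf; rewrite -/gm in H1 *.
move: H1 H2 H3 H4 Hf Hg (norm2_ge0 fm) (norm2_ge0 (cloud_mean g))
  (norm2_ge0 (cloud_rest f)) (norm2_ge0 (cloud_rest g)).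
rewrite {}Nf {}Ng.
move: (dot fm gm) (dot fm gr) (dot fr gm) (dot fr gr) (norm2 fr)
  (norm2 (cloud_walk (cloud_rest g))) => d1 d2 d3 d4 n1 n2.
move: (norm2 fm) (norm2 (cloud_mean g)) (norm2 (cloud_rest f)) (norm2 (cloud_rest g)).
move=> m1 m2 r1 r2 H1 H2 H3 H4 Hf Hg m10 m20 r10 r20.
have Hf' : (a * q)^-1 * n1 <= a * q * r1.
  by rewrite mulrC ler_pdivrMr //; apply: (le_trans Hf); rewrite expr2; lra.
have Hg' : (a * q)^-1 * n2 <= a * q * r2.
  by rewrite mulrC ler_pdivrMr //; apply: (le_trans Hg); rewrite expr2; lra.
have q20 : 0 < q ^+ 2 by rewrite exprn_gt0.
have G1 : q ^+ 2 * (2 * d1) <= q ^+ 2 * (e * (m1 + m2)) by rewrite ler_pM2l.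
have G2 : q * (2 * d2) <= q * (a * q * m1 + a * q * r2).
  by rewrite ler_pM2l //; apply: (le_trans H2); rewrite lerD2l.
have G3 : q * (2 * d3) <= q * (a * q * r1 + a * q * m2).
  by rewrite ler_pM2l //; apply: (le_trans H3); rewrite lerD2r.
have G4 : 2 * d4 <= (a * q) ^+ 2 * r1 + (a * q) ^+ 2 * r2.
  by apply: (le_trans H4); rewrite lerD.
have G5 : 0 <= a ^+ 2 * q ^+ 2 * (m1 + m2).
  by rewrite mulr_ge0 ?addr_ge0 // mulr_ge0 // sqr_ge0.
have G6 : 0 <= e * q ^+ 2 * (r1 + r2).
  by rewrite mulr_ge0 ?addr_ge0 // mulr_ge0 ?sqr_ge0 // ltW.
lra.
Qed.

End ZigZag.

(** * Expanders from affine planes *)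

Section AffinePlane.
Variables (R : realType) (F : finFieldType).

(** The point [(a, b)] is joined to [(c, y)] when [b + y = a * c + t]: points
    against lines of the affine plane, written as a symmetric relation.  For
    different [t] these graphs have no common edge. *)
Definition plane_rot (t : F) (x : (F * F) * F) : (F * F) * F :=
  ((x.2, x.1.1 * x.2 + t - x.1.2), x.1.1).

Lemma plane_rotK t : involutive (plane_rot t).
Proof.
move=> [[a b] c]; rewrite /plane_rot /=; congr ((_, _), _).
ring.
Qed.

(** Two points with different first coordinates have exactly one common
    neighbour, and two points that differ only in the second coordinate have
    none.  So the quadratic form of the squared adjacency operator is [#|F|]
    times the squared norm, plus terms that depend only on the sums of [f] over
    the lines with constant first coordinate.  As these sums add up to zero, the
    additional terms amount to minus a sum of squares. *)
Lemma plane_norm2 t (f : F * F -> R) : \sum_x f x = 0 ->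
  norm2 (walk (plane_rot t) f) <= #|F|%:R * norm2 f.
Proof.
move=> f0.
pose S c := \sum_y f (c, y).
(* Expanding the square, [X c c'] collects the products of values of [f] above
   the two neighbours with first coordinates [c] and [c']. *)
pose X c c' := \sum_(x : F * F)
  f (c, x.1 * c + t - x.2) * f (c', x.1 * c' + t - x.2).
have -> : norm2 (walk (plane_rot t) f) = \sum_c \sum_c' X c c'.
  rewrite /norm2 /dot /walk.
  under eq_bigr do rewrite big_distrlr /=.
  rewrite exchange_big; apply: eq_bigr => c _.
  by rewrite exchange_big.
have Xdiag c : X c c = #|F|%:R * \sum_y f (c, y) * f (c, y).
  rewrite /X -(pair_bigA _ (fun a b => f (c, a * c + t - b) * f (c, a * c + t - b))) /=.
  have E a : \sum_b f (c, a * c + t - b) * f (c, a * c + t - b) =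
             \sum_y f (c, y) * f (c, y).
    rewrite [RHS](reindex_inj (inv_inj (_ : involutive (fun b => a * c + t - b)))) //.
    by move=> b; rewrite opprB addrC subrK.
  by under eq_bigr do rewrite E; rewrite sumr_const mulr_natl.
have Xoff c c' : c' != c -> X c c' = S c * S c'.
  move=> cc'; have d0 : c - c' != 0 by rewrite subr_eq0 eq_sym.
  rewrite /S big_distrlr pair_bigA /=.
  rewrite [RHS](reindex (fun x : F * F => (x.1 * c + t - x.2, x.1 * c' + t - x.2))) //.
  exists (fun y : F * F => let a := (y.1 - y.2) / (c - c') in
    (a, a * c + t - y.1)) => [[a b] _|[y y'] _] /=.
    have -> : (a * c + t - b - (a * c' + t - b)) / (c - c') = a by field.
    by congr (_, _); ring.
  by congr (_, _); field.
have -> : \sum_c \sum_c' X c c' = #|F|%:R * norm2 f - \sum_c S c ^+ 2.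
  have -> : norm2 f = \sum_c \sum_y f (c, y) * f (c, y).
    by rewrite pair_bigA; apply: eq_bigr => -[].
  rewrite mulr_sumr -sumrB; apply: eq_bigr => c _.
  rewrite (bigD1 c) //= Xdiag; congr (_ + _).
  have S0 : \sum_c S c = 0.
    by rewrite /S pair_bigA -[RHS]f0; apply: eq_bigr => -[].
  under eq_bigr => c' c'c do rewrite Xoff //.
  rewrite -mulr_sumr; move: S0; rewrite (bigD1 c) //= => S0.
  by rewrite expr2 -mulrN; congr (_ * _); apply/eqP; rewrite -addr_eq0 addrC S0.
by rewrite gerBl; apply: sumr_ge0 => c _; exact: sqr_ge0.
Qed.

Lemma plane_contracts t (a : R) : 1 <= a ^+ 2 * #|F|%:R ->
  contracts (walk (plane_rot t)) (a * #|F|%:R).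
Proof.
move=> a1 f /(plane_norm2 t) H; apply: (le_trans H).
rewrite ler_wpM2r ?norm2_ge0 // exprMn [X in _ * X]expr2 mulrA.
by rewrite ler_peMl ?ler0n.
Qed.

Lemma plane_expander (a : R) : 1 <= a ^+ 2 * #|F|%:R ->
  expander (F * F)%type F a.
Proof.
move=> a1; exists (plane_rot 0); first exact: plane_rotK.
exact: plane_contracts.
Qed.

End AffinePlane.

(** * An infinite family of bounded degree *)

Section Family.
Variable R : realType.

Lemma expander_zigzag (V K E : finType) (e a : R) :
  (0 < #|K|)%N -> (0 < #|E|)%N -> 0 < e -> 0 < a ->
  expander V K e -> expander K E a ->
  expander (V * K)%type (E * E)%type (e + a + a ^+ 2).
Proof.
move=> K0 E0 e0 a0 [rG rGK HG] [rH rHK HH].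
exists (zigzag rG rH); first exact: zigzagK.
exact: zigzag_contracts.
Qed.

Lemma large_prime (N : nat) (a : R) : 0 < a ->
  exists p, [/\ prime p, (N <= p)%N & 1 <= a ^+ 2 * p%:R].
Proof.
move=> a0; have a20 : 0 < a ^+ 2 by rewrite exprn_gt0.
have [p + pp] := prime_above (maxn N (Num.bound (a ^- 2))).
rewrite gtn_max => /andP[/ltnW Np pM].
exists p; split=> //; rewrite mulrC -ler_pdivrMr // div1r ltW //.
apply: (lt_le_trans (archi_boundP _)); first by rewrite invr_ge0 ltW.
by rewrite ler_nat ltnW.
Qed.

(** The small graph of the recursion.  To undo a squaring of degrees, it needs
    as many vertices as the fourth power of its own degree.  An affine plane
    has only the square, so start with the plane over the field with [p ^ 2]
    elements, whose degree is the number of points of the plane over ['F_p],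
    and take two zig-zag products with the latter: this gives [p ^ 8] vertices
    and degree [p ^ 2]. *)
Lemma fourth_power_expander (a : R) : 0 < a -> a <= 1 ->
  exists2 E : finType, (1 < #|E|)%N &
  expander ((E * E) * (E * E))%type E (5 * a).
Proof.
move=> a0 a1; have [p [pp _ ap]] := large_prime 0 a0.
have [F2 _ cF2] := pPrimePowerField pp (isT : (0 < 2)%N).
have cF : #|'F_p| = p by exact: card_Fp.
have p0 : (0 < p)%N := prime_gt0 pp.
have HF : expander ('F_p * 'F_p)%type 'F_p a.
  by apply: plane_expander; rewrite cF.
have HF2 : expander (F2 * F2)%type ('F_p * 'F_p)%type a.
  apply: (@expander_card _ (F2 * F2)%type _ F2); rewrite // ?card_prod ?cF ?cF2 ?mulnn //.
  apply: plane_expander; rewrite cF2 natrX (le_trans ap) // ler_wpM2l ?sqr_ge0 //.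
  by rewrite -natrX ler_nat leq_pmull.
have c0 : (0 < #|{: 'F_p * 'F_p}|)%N by rewrite card_prod cF muln_gt0 p0.
have c1 : (0 < #|'F_p|)%N by rewrite cF.
have b0 : 0 < a + a + a ^+ 2 by rewrite !addr_gt0 // exprn_gt0.
have := expander_zigzag c0 c1 b0 a0 (expander_zigzag c0 c1 a0 a0 HF2 HF) HF.
move=> H; exists ('F_p * 'F_p)%type.
  by rewrite card_prod cF (leq_trans (prime_gt1 pp)) // leq_pmull.
apply: (expander_le _ _ (expander_card _ _ H)); rewrite ?card_prod ?cF ?cF2 //.
- by rewrite ltW // !addr_gt0 // exprn_gt0.
- have : a ^+ 2 <= a by rewrite expr2 ger_pMl.
  lra.
- by rewrite -!mulnn; lia.
Qed.

(** The recursion of Reingold, Vadhan and Wigderson: replace [G] by the zig-zag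
    product of its square with [H].  Squaring turns the ratio [2 * a] into
    [4 * a ^+ 2], so that the loss [a + a ^+ 2] of the zig-zag product can be
    afforded as soon as [5 * a <= 1]. *)
Lemma expander_unbounded (E : finType) (a : R) : (1 < #|E|)%N ->
  0 < a -> 5 * a <= 1 -> expander ((E * E) * (E * E))%type E a ->
  forall N, exists2 V : finType, (N < #|V|)%N & expander V (E * E)%type (2 * a).
Proof.
move=> E1 a0 a5 H; have E0 := ltnW E1; elim=> [|N [V NV HV]].
  exists ((E * E) * (E * E))%type; first by rewrite !card_prod !muln_gt0 E0.
  apply: (expander_le _ _ (expander_square H)); first exact: sqr_ge0.
  by rewrite expr2 ler_pM2r //; lra.
have K0 : (0 < #|{: (E * E) * (E * E)}|)%N by rewrite !card_prod !muln_gt0 E0.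
have e0 : 0 < (2 * a) ^+ 2 by rewrite exprn_gt0 // mulr_gt0.
have HV' := expander_zigzag K0 E0 e0 a0 (expander_square HV) H.
exists (V * ((E * E) * (E * E)))%type.
  rewrite card_prod (leq_ltn_trans NV) // ltn_Pmulr ?(leq_ltn_trans _ NV) //.
  by rewrite !card_prod; nia.
apply: (expander_le _ _ HV'); first by rewrite !addr_ge0 ?sqr_ge0 // ltW.
have : a ^+ 2 * 5 <= a by rewrite expr2 -mulrA ger_pMr //; lra.
by rewrite exprMn; lra.
Qed.

Lemma expander_family (e : R) : 0 < e ->
  exists2 K : finType, (0 < #|K|)%N &
  forall N, exists2 V : finType, (N <= #|V|)%N & expander V K e.
Proof.
move=> e0; pose a := Num.min (25%:R^-1) (e / 10%:R).
have a0 : 0 < a by rewrite lt_min invr_gt0 divr_gt0 ?ltr0n.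
have ae : a <= e / 10%:R by rewrite ge_min lexx orbT.
have a25 : a <= 25%:R^-1 by rewrite ge_min lexx.
have a1 : a <= 1 by lra.
have [E E1 HE] := fourth_power_expander a0 a1.
exists (E * E)%type; first by rewrite card_prod muln_gt0 ltnW.
move=> N; have [||V NV HV] := expander_unbounded E1 _ _ HE N; try lra.
exists V; first exact: ltnW.
apply: (expander_le _ _ HV); lra.
Qed.

End Family.

(** * Removing multiple edges *)

Section Kernels.
Variables (R : realType) (U : finType).
Implicit Types (k : U -> U -> nat) (f g : U -> R).

Definition kernel_op k f x : R := \sum_y (k x y)%:R * f y.

Definition gap k (c : R) := forall f g, \sum_x f x = 0 -> \sum_x g x = 0 ->
  2 * dot f (kernel_op k g) <= c * (norm2 f + norm2 g).

Lemma dot_kernel_op k f g :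
  dot f (kernel_op k g) = \sum_x \sum_y (k x y)%:R * (f x * g y).
Proof.
by apply: eq_bigr => x _; rewrite mulr_sumr; apply: eq_bigr => y _; rewrite mulrCA.
Qed.

Section Regular.
Variables (k : U -> U -> nat) (d : nat).
Hypotheses (kC : forall x y, k x y = k y x) (kd : forall x, (\sum_y k x y = d)%N).

Lemma regular_form_sum f g :
  \sum_x \sum_y (k x y)%:R * (f x * f x + g y * g y) = d%:R * (norm2 f + norm2 g).
Proof.
have row h : \sum_x \sum_y (k x y)%:R * (h x * h x) = d%:R * norm2 h.
  rewrite mulr_sumr; apply: eq_bigr => x _.
  by rewrite -mulr_suml -natr_sum kd.
rewrite mulrDr -!row [X in _ + X]exchange_big -big_split.
apply: eq_bigr => x _; rewrite -big_split; apply: eq_bigr => y _ /=.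
by rewrite (kC y x) mulrDr.
Qed.

(** A symmetric nonnegative kernel with row sums [d] has norm at most [d]; the
    two inequalities bound the form from both sides. *)
Lemma regular_form_le f g : 2 * dot f (kernel_op k g) <= d%:R * (norm2 f + norm2 g).
Proof.
rewrite dot_kernel_op -regular_form_sum mulr_sumr; apply: ler_sum => x _.
rewrite mulr_sumr; apply: ler_sum => y _.
rewrite mulrCA ler_wpM2l ?ler0n // -subr_ge0.
have -> : f x * f x + g y * g y - 2 * (f x * g y) = (f x - g y) ^+ 2 by ring.
exact: sqr_ge0.
Qed.

Lemma regular_form_ge f g : - (2 * dot f (kernel_op k g)) <= d%:R * (norm2 f + norm2 g).
Proof.
have := regular_form_le (fun x => -1 * f x) g.
by rewrite norm2Z dotZl sqrrN expr1n !mul1r mulN1r mulrN.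
Qed.

End Regular.

End Kernels.

Section Multiplicity.
Variables (R : realType) (V K : finType).

Lemma sum_indicator (T : finType) (h : T -> R) u : \sum_v (v == u)%:R * h v = h u.
Proof.
rewrite (bigD1 u) //= eqxx mul1r big1 ?addr0 // => v /negPf->.
by rewrite mul0r.
Qed.

Lemma expander_multigraph (e : R) : (0 < #|K|)%N -> 0 < e -> expander V K e ->
  exists M : V -> V -> nat, [/\ forall u v, M u v = M v u,
    forall u, (\sum_v M u v = #|K|)%N & gap M (e * #|K|%:R)].
Proof.
move=> K0 e0 [rot rotK H].
pose M u v := (\sum_(k : K) ((rot (u, k)).1 == v))%N.
have ME u v : (M u v)%:R = walk rot (fun w => (w == v)%:R : R) u.
  by rewrite natr_sum.
exists M; split=> [u v|u|f g f0 g0].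
- apply/eqP; rewrite -(eqr_nat R) !ME; apply/eqP.
  rewrite -(sum_indicator (walk rot _) u) [LHS](dot_walk rotK).
  by rewrite dotC [LHS]sum_indicator.
- rewrite exchange_big /= -sum1_card; apply: eq_bigr => k _.
  rewrite (bigD1 (rot (u, k)).1) //= eqxx big1 // => v /negPf.
  by rewrite eq_sym => ->.
have -> : dot f (kernel_op M g) = dot f (walk rot g).
  apply: eq_dot => // u; rewrite /kernel_op.
  under eq_bigr do rewrite natr_sum mulr_suml.
  rewrite exchange_big; apply: eq_bigr => k _ /=.
  rewrite -(sum_indicator g); apply: eq_bigr => v _.
  by rewrite eq_sym.
by apply: contracts_dot => //; rewrite mulr_gt0 ?ltr0n.
Qed.

End Multiplicity.

Section Lift.
Variables (R : realType) (F : finFieldType) (e : R).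
Hypotheses (e_gt0 : 0 < e) (eF : 1 <= e ^+ 2 * #|F|%:R).
Let q : R := #|F|%:R.
Let q_gt0 : 0 < q. Proof. by rewrite ltr0n; apply/card_gt0P; exists 0. Qed.

(** The bilinear form of an affine plane without a restriction on the sums of
    the functions: the mean of [g] accounts for the rank one term. *)
Lemma plane_form t (f g : F * F -> R) :
  2 * dot f (walk (plane_rot t) g) <=
  2 / q * ((\sum_x f x) * (\sum_x g x)) + e * q * (norm2 f + norm2 g).
Proof.
set SF := \sum_x f x; set SG := \sum_x g x.
pose m := SG / q ^+ 2; pose g' x := g x + - m * 1.
have q0 : q != 0 by rewrite gt_eqF.
have cFF : \sum_(x : F * F) (1 : R) = q ^+ 2.
  by rewrite sumr_const card_prod natrM.
have g'0 : \sum_x g' x = 0.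
  by rewrite big_split /= -mulr_sumr cFF /m -/SG; field.
have -> : dot f (walk (plane_rot t) g) =
    m * q * SF + dot f (walk (plane_rot t) g').
  have -> : dot f (walk (plane_rot t) g) =
      dot f (fun v => m * q * 1 + walk (plane_rot t) g' v).
    apply: eq_dot => // v; rewrite mulr1 [m * q]mulrC -(walk_cst (plane_rot t) m v).
    rewrite /walk -big_split; apply: eq_bigr => c _.
    by rewrite /g' mulr1 /= addrC subrK.
  rewrite dotDr dotZr; congr (_ * _ + _).
  by apply: eq_bigr => x _; rewrite mulr1.
have n1 : norm2 g' <= norm2 g.
  rewrite [norm2 g'](norm2D g (fun x => - m * 1)) norm2Z dotZr.
  have -> : norm2 (fun _ : F * F => 1 : R) = q ^+ 2.
    by rewrite -cFF /norm2; apply: eq_bigr => x _; rewrite mulr1.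
  have -> : dot g (fun _ : F * F => 1) = m * q ^+ 2.
    rewrite /m divfK ?expf_neq0 //.
    by apply: eq_bigr => x _; rewrite mulr1.
  have : 0 <= m ^+ 2 * q ^+ 2 by rewrite -exprMn sqr_ge0.
  by lra.
have H := contracts_dot f (mulr_gt0 e_gt0 q_gt0) (plane_contracts t eF) g'0.
have -> : 2 / q * (SF * SG) = 2 * (m * q * SF) by rewrite /m; field.
rewrite mulrDr lerD2l; apply: (le_trans H).
by rewrite ler_pM2l ?mulr_gt0 // lerD2l.
Qed.

(** The union of the edge-disjoint graphs [plane_rot t] over the first [m]
    field elements [t]. *)
Definition plane_band (m : nat) (x y : F * F) : nat :=
  (enum_rank (x.2 + y.2 - x.1 * y.1)%R < m)%N.

Lemma card_rank_lt (T : finType) m : (m <= #|T|)%N ->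
  (\sum_(t : T | (enum_rank t < m)%N) 1 = m)%N.
Proof.
move=> mT; rewrite (reindex (@enum_val T predT)) /=; last first.
  by apply: onW_bij; apply: enum_val_bij.
under eq_bigl do rewrite enum_valK.
by rewrite -(big_ord_widen _ (fun=> 1%N) mT) sum1_card card_ord.
Qed.

Lemma kernel_op_plane_band m (g : F * F -> R) x :
  kernel_op (plane_band m) g x =
  \sum_(t | (enum_rank t < m)%N) walk (plane_rot t) g x.
Proof.
have -> : kernel_op (plane_band m) g x =
    \sum_c \sum_y (plane_band m x (c, y))%:R * g (c, y).
  by rewrite pair_bigA; apply: eq_bigr => -[].
rewrite [RHS]exchange_big; apply: eq_bigr => c _ /=.
rewrite (reindex (fun t => x.1 * c + t - x.2)) /=; last first.
  by apply: onW_bij; exists (fun y => y + x.2 - x.1 * c) => z; ring.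
rewrite [RHS]big_mkcond; apply: eq_bigr => t _; rewrite /plane_band /=.
have -> : x.2 + (x.1 * c + t - x.2) - x.1 * c = t by ring.
by case: ifP => _; rewrite ?mul1r ?mul0r.
Qed.

Lemma plane_band_form m (f g : F * F -> R) : (m <= #|F|)%N ->
  2 * dot f (kernel_op (plane_band m) g) <=
  m%:R * (2 / q * ((\sum_x f x) * (\sum_x g x)) + e * q * (norm2 f + norm2 g)).
Proof.
move=> mF.
have -> : dot f (kernel_op (plane_band m) g) =
    \sum_(t : F | (enum_rank t < m)%N) dot f (walk (plane_rot t) g).
  rewrite exchange_big; apply: eq_bigr => x _.
  by rewrite kernel_op_plane_band mulr_sumr.
rewrite -[X in _ <= X%:R * _](card_rank_lt mF) natr_sum mulr_suml mulr_sumr.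
by apply: ler_sum => t _; rewrite mul1r plane_form.
Qed.

Lemma plane_band_deg m x : (m <= #|F|)%N -> (\sum_y plane_band m x y = m * #|F|)%N.
Proof.
move=> mF; apply/eqP; rewrite -(eqr_nat R) natr_sum.
have -> : \sum_y (plane_band m x y)%:R = kernel_op (plane_band m) (fun=> 1 : R) x.
  by apply: eq_bigr => y _; rewrite mulr1.
rewrite kernel_op_plane_band; under eq_bigr do rewrite walk_cst mulr1.
rewrite natrM -[X in _ == X%:R * _](card_rank_lt mF) natr_sum mulr_suml.
by apply/eqP; apply: eq_bigr => t _; rewrite mul1r.
Qed.

(** Multiple edges and loops of a multigraph [M] are resolved by putting a plane
    [F * F] above each vertex and [M u v] disjoint affine planes above each pair
    [u, v].  The terms of rank one reproduce the form of [M]; the remainders are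
    bounded by [e] times the degree, by the gap of the affine planes. *)
Lemma simple_lift (V : finType) (D : nat) (M : V -> V -> nat) :
  (forall u v, M u v = M v u) -> (forall u, (\sum_v M u v = D)%N) ->
  (D <= #|F|)%N -> gap M (e * D%:R) ->
  exists L : rel (V * (F * F)), [/\ symmetric L,
    forall x, (\sum_y L x y = D * #|F|)%N &
    gap L (2 * e * (D * #|F|)%:R)].
Proof.
move=> MC MD DF HM.
have MF u v : (M u v <= #|F|)%N.
  by apply: leq_trans DF; rewrite -(MD u) (bigD1 v) //= leq_addr.
pose L (x y : V * (F * F)) :=
  (enum_rank (x.2.2 + y.2.2 - x.2.1 * y.2.1)%R < M x.1 y.1)%N.
have LE x y : L x y = plane_band (M x.1 y.1) x.2 y.2 :> nat by [].
exists L; split=> [x y|[u x]|f g f0 g0].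
- by rewrite /L MC [x.2.2 + _]addrC [x.2.1 * _]mulrC.
- have -> : (\sum_y L (u, x) y = \sum_v \sum_y L (u, x) (v, y))%N.
    by rewrite pair_bigA; apply: eq_bigr => -[].
  under eq_bigr => v _ do rewrite (plane_band_deg x (MF u v)).
  by rewrite -big_distrl /= MD.
pose f' u x := f (u, x); pose g' u x := g (u, x).
have -> : dot f (kernel_op L g) =
    \sum_u \sum_v dot (f' u) (kernel_op (plane_band (M u v)) (g' v)).
  have -> : dot f (kernel_op L g) =
      \sum_u \sum_x \sum_y (L (u, x) y)%:R * (f (u, x) * g y).
    by rewrite dot_kernel_op [RHS]pair_bigA; apply: eq_bigr => -[].
  apply: eq_bigr => u _.
  under [RHS]eq_bigr do rewrite dot_kernel_op.
  rewrite [RHS]exchange_big; apply: eq_bigr => x _ /=.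
  by rewrite pair_bigA; apply: eq_bigr => -[].
pose SF u := \sum_x f' u x; pose SG u := \sum_x g' u x.
have SF0 : \sum_u SF u = 0 by rewrite -[RHS]f0 /SF pair_bigA; apply: eq_bigr => -[].
have SG0 : \sum_u SG u = 0 by rewrite -[RHS]g0 /SG pair_bigA; apply: eq_bigr => -[].
have nS (h : V * (F * F) -> R) : norm2 h = \sum_u norm2 (fun x => h (u, x)).
  by rewrite /norm2 /dot pair_bigA; apply: eq_bigr => -[].
have leS (h : V * (F * F) -> R) : norm2 (fun u => \sum_x h (u, x)) <= q ^+ 2 * norm2 h.
  rewrite nS mulr_sumr; apply: ler_sum => u _.
  by rewrite -expr2 (le_trans (sqr_sum_le _)) // card_prod natrM.
have -> : 2 * (\sum_u \sum_v dot (f' u) (kernel_op (plane_band (M u v)) (g' v))) =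
   \sum_u \sum_v 2 * dot (f' u) (kernel_op (plane_band (M u v)) (g' v)).
  by rewrite mulr_sumr; apply: eq_bigr => u _; rewrite mulr_sumr.
apply: (@le_trans _ _ (\sum_u \sum_v (M u v)%:R *
   (2 / q * (SF u * SG v) + e * q * (norm2 (f' u) + norm2 (g' v))))).
  by apply: ler_sum => u _; apply: ler_sum => v _; exact: plane_band_form.
have -> : \sum_u \sum_v (M u v)%:R *
   (2 / q * (SF u * SG v) + e * q * (norm2 (f' u) + norm2 (g' v))) =
   q^-1 * (2 * dot SF (kernel_op M SG)) + e * q * (D%:R * (norm2 f + norm2 g)).
  have -> : D%:R * (norm2 f + norm2 g) =
      \sum_u \sum_v (M u v)%:R * (norm2 (f' u) + norm2 (g' v)).
    have row (h : V * (F * F) -> R) :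
        \sum_u \sum_v (M u v)%:R * norm2 (fun x => h (u, x)) = D%:R * norm2 h.
      rewrite nS mulr_sumr; apply: eq_bigr => u _.
      by rewrite -mulr_suml -natr_sum MD.
    rewrite mulrDr -!row [X in _ + X]exchange_big -big_split.
    apply: eq_bigr => u _; rewrite -big_split; apply: eq_bigr => v _ /=.
    by rewrite (MC v u) mulrDr.
  rewrite dot_kernel_op !mulr_sumr -big_split; apply: eq_bigr => u _.
  rewrite !mulr_sumr -big_split; apply: eq_bigr => v _ /=; ring.
have HS := HM _ _ SF0 SG0.
have q0 : q != 0 by rewrite gt_eqF.
have D0 : 0 <= D%:R :> R by rewrite ler0n.
rewrite natrM -/q.
have -> : 2 * e * (D%:R * q) * (norm2 f + norm2 g) =
    q^-1 * (e * D%:R * (q ^+ 2 * norm2 f + q ^+ 2 * norm2 g)) +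
    e * q * (D%:R * (norm2 f + norm2 g)) by field.
rewrite lerD2r ler_pM2l ?invr_gt0 //; apply: (le_trans HS).
by rewrite ler_wpM2l ?mulr_ge0 ?lerD ?leS // ltW.
Qed.

End Lift.

(** * The blow-up *)

Section SimpleFamily.
Variable R : realType.

(** The relation [L] may still have loops; they disappear in the blow-up. *)
Lemma simple_expander_family (e : R) : 0 < e ->
  exists2 d : nat, (0 < d)%N &
  forall N, exists2 U : finType, (N <= #|U|)%N &
  exists L : rel U, [/\ symmetric L, forall x, (\sum_y L x y = d)%N &
    gap L (e * d%:R)].
Proof.
move=> e0; have e20 : 0 < e / 2 by rewrite divr_gt0.
have [K K0 HK] := expander_family e20.
have [p [pp Kp pe]] := large_prime #|K| e20.
have cF : #|'F_p| = p by exact: card_Fp.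
rewrite -cF in Kp pe.
exists (#|K| * #|'F_p|)%N; first by rewrite muln_gt0 K0 cF prime_gt0.
move=> N; have [V NV /(expander_multigraph K0 e20)[M [MC MD HM]]] := HK N.
have [L [LC Ld HL]] := simple_lift e20 pe MC MD Kp HM.
exists (V * ('F_p * 'F_p))%type.
  by rewrite card_prod (leq_trans NV) // leq_pmulr // card_prod cF muln_gt0 prime_gt0.
by exists L; split=> //; move: HL; rewrite [2 * _]mulrC divfK ?pnatr_eq0.
Qed.

End SimpleFamily.

Section BlowUp.
Variables (U : finType) (L : rel U) (s h r : nat).

(** The blob of [p : U * 'I_s] is the set of vertices above [p].  Different
    blobs are joined completely or not at all, following [L]; asking for
    different elements of ['I_s] removes the loops of [L] at a small cost in the
    spectrum.  Inside each blob lives an [r]-regular bipartite graph, by which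
    the degree can be adjusted to any prescribed value.  The blob size
    [2 * h] is even, so that no parity obstruction arises. *)
Definition blowup_vertex : finType := ((U * 'I_s) * (bool * 'I_h))%type.
Implicit Types x y : blowup_vertex.

Definition blob_edge (p p' : U * 'I_s) : bool := L p.1 p'.1 && (p.2 != p'.2).

(** Testing the sum of the two positions, and not their difference, makes the
    relation symmetric as it stands. *)
Definition filler_edge (z z' : bool * 'I_h) : bool :=
  (z.1 != z'.1) && ((z.2 + z'.2) %% h < r)%N.

Definition blowup_edge : rel blowup_vertex := fun x y =>
  blob_edge x.1 y.1 || ((x.1 == y.1) && filler_edge x.2 y.2).

Hypothesis LC : symmetric L.

Lemma filler_edgeC z z' : filler_edge z z' = filler_edge z' z.
Proof. by rewrite /filler_edge eq_sym addnC. Qed.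

Lemma blowup_edge_sym : symmetric blowup_edge.
Proof.
move=> x y; rewrite /blowup_edge /blob_edge LC [x.1.2 == _]eq_sym.
by rewrite [x.1 == _]eq_sym filler_edgeC.
Qed.

Lemma blowup_edge_irr : irreflexive blowup_edge.
Proof.
by move=> x; rewrite /blowup_edge /blob_edge /filler_edge !eqxx andbF.
Qed.

Definition blowup : sgraph := SGraph blowup_edge_sym blowup_edge_irr.

Lemma filler_deg z : (r <= h)%N -> (\sum_z' filler_edge z z' = r)%N.
Proof.
case: z => b i rh; have h0 : (0 < h)%N by case: (h) i => [[]|].
have -> : (\sum_z' filler_edge (b, i) z' = \sum_b' \sum_i' filler_edge (b, i) (b', i'))%N.
  by rewrite pair_bigA; apply: eq_bigr => -[].
rewrite (bigD1 (~~ b)) //= [X in (_ + X)%N]big1 ?addn0; last first.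
  by move=> b' bb'; rewrite big1 // => i' _; rewrite /filler_edge; case: b b' bb' => [] [].
(* Rotation by [i] permutes the positions. *)
pose t (i' : 'I_h) : 'I_h := Ordinal (ltn_pmod (i + i') h0).
have tI : injective t.
  move=> a a' /(congr1 val) /= /eqP; rewrite eqn_modDl !modn_small // => /eqP.
  exact: val_inj.
have -> : (\sum_i' filler_edge (b, i) (~~ b, i') = \sum_(i' : 'I_h) (t i' < r)%N)%N.
  by apply: eq_bigr => i' _; rewrite /filler_edge /=; case: b.
have -> : (\sum_(i' : 'I_h) (t i' < r)%N = \sum_(i' : 'I_h) (i' < r)%N)%N.
  by rewrite [RHS](reindex_inj tI).
rewrite -[RHS]card_ord -sum1_card (big_ord_widen _ (fun=> 1%N) rh) [RHS]big_mkcond.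
by apply: eq_bigr => i' _; case: ltnP.
Qed.

Variable d : nat.
Hypothesis Ld : forall u, (\sum_v L u v = d)%N.

Lemma blob_deg p : (\sum_p' blob_edge p p' = d * s.-1)%N.
Proof.
have -> : (\sum_p' blob_edge p p' = \sum_v \sum_j blob_edge p (v, j))%N.
  by rewrite pair_bigA; apply: eq_bigr => -[].
rewrite -(Ld p.1) big_distrl /=; apply: eq_bigr => v _.
rewrite /blob_edge /=; case: (L _ _) => /=; last by rewrite big1.
rewrite mul1n -[X in _ = X.-1](card_ord s) -(cardC1 p.2) -sum1_card [RHS]big_mkcond.
by apply: eq_bigr => j _; rewrite !inE eq_sym; case: eqP.
Qed.

Lemma blowup_edgeE x y : blowup_edge x y =
  (blob_edge x.1 y.1 + (x.1 == y.1) * filler_edge x.2 y.2)%N :> nat.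
Proof.
rewrite /blowup_edge; case: eqP => [->|_]; last by rewrite orbF addn0.
by rewrite /blob_edge eqxx andbF /= mul1n.
Qed.

Lemma sum_blowup (F : blowup_vertex -> nat) :
  (\sum_x F x = \sum_p \sum_z F (p, z))%N.
Proof. by rewrite pair_bigA; apply: eq_bigr => -[]. Qed.

Definition blob_kernel x y : nat := blob_edge x.1 y.1.
Definition filler_kernel x y : nat := ((x.1 == y.1) * filler_edge x.2 y.2)%N.

Lemma filler_kernel_deg x : (r <= h)%N -> (\sum_y filler_kernel x y = r)%N.
Proof.
move=> rh; rewrite (sum_blowup (filler_kernel x)) (bigD1 x.1) //=.
rewrite [X in (_ + X)%N]big1 ?addn0.
  rewrite -[RHS](filler_deg x.2 rh); apply: eq_bigr => z _.
  by rewrite /filler_kernel eqxx mul1n.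
move=> p /negPf; rewrite eq_sym => xp; rewrite big1 // => z _.
by rewrite /filler_kernel xp.
Qed.

Lemma blowup_regular : (r <= h)%N -> regular blowup (d * s.-1 * (2 * h) + r).
Proof.
move=> rh x; rewrite -sum1_card big_mkcond /=.
have -> : (\sum_(y : blowup) (if y \in [set y | edge x y]%SET then 1 else 0) =
   \sum_y blob_kernel x y + \sum_y filler_kernel x y)%N.
  rewrite -big_split; apply: eq_bigr => y _; rewrite inE /= -[LHS]/(_ : nat).
  by rewrite -[RHS]blowup_edgeE; case: blowup_edge.
rewrite filler_kernel_deg //; congr (_ + _)%N.
rewrite (sum_blowup (blob_kernel x)) -(blob_deg x.1) big_distrl /=.
apply: eq_bigr => p _; rewrite /blob_kernel /= sum_nat_const mulnC; congr (_ * _)%N.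
by rewrite card_prod card_bool card_ord.
Qed.

Lemma card_blowup : #|blowup| = (#|U| * s * (2 * h))%N.
Proof. by rewrite /= !card_prod card_bool !card_ord. Qed.

(** The adjacency kernel is the complete blow-up of [L], minus its diagonal part
    with respect to ['I_s], plus the filler graphs.  The gap of [L] controls the
    first term; the others are regular, so their norm is at most their degree. *)
Lemma blowup_gap (R : realType) (c : R) : (r <= h)%N -> 0 < c -> gap L c ->
  gap blowup_edge (c * (s * (2 * h))%:R + (d * (2 * h))%:R + r%:R).
Proof.
move=> rh c0 HL f g f0 g0.
pose K1 x y : nat := L x.1.1 y.1.1.
pose K2 x y : nat := L x.1.1 y.1.1 && (x.1.2 == y.1.2).
have K2C x y : K2 x y = K2 y x by rewrite /K2 LC eq_sym.
have KFC x y : filler_kernel x y = filler_kernel y x.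
  by rewrite /filler_kernel eq_sym filler_edgeC.
have K2d x : (\sum_y K2 x y = d * (2 * h))%N.
  rewrite (sum_blowup (K2 x)) -(Ld x.1.1) big_distrl /=.
  have -> : (\sum_p \sum_z K2 x (p, z) = \sum_v \sum_j \sum_z K2 x ((v, j), z))%N.
    by rewrite [RHS]pair_bigA; apply: eq_bigr => -[].
  apply: eq_bigr => v _; rewrite (bigD1 x.1.2) //= [X in (_ + X)%N]big1 ?addn0.
    rewrite /K2 /= sum_nat_const mulnC eqxx andbT; congr (_ * _)%N.
    by rewrite card_prod card_bool card_ord.
  move=> j /negPf; rewrite eq_sym => xj; rewrite big1 // => z _.
  by rewrite /K2 /= xj andbF.
have -> : dot f (kernel_op blowup_edge g) =
    dot f (kernel_op K1 g) - dot f (kernel_op K2 g) +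
    dot f (kernel_op filler_kernel g).
  rewrite !dot_kernel_op -sumrB -big_split; apply: eq_bigr => x _ /=.
  rewrite -sumrB -big_split; apply: eq_bigr => y _ /=.
  rewrite blowup_edgeE natrD -mulrBl -mulrDl; congr (_ * _); congr (_ + _).
  rewrite /K1 /K2 /blob_edge.
  by case: (L _ _); case: eqP; rewrite /= ?subrr ?subr0.
pose SF (f : blowup_vertex -> R) u := \sum_(w : 'I_s * (bool * 'I_h)) f ((u, w.1), w.2).
have SE (f' : blowup_vertex -> R) : \sum_x f' x = \sum_u SF f' u.
  rewrite /SF pair_bigA /=.
  rewrite (reindex (fun p : U * ('I_s * (bool * 'I_h)) => ((p.1, p.2.1), p.2.2))) //.
  by exists (fun x : blowup_vertex => (x.1.1, (x.1.2, x.2))) => [[? []]|[[]]].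
have H1 : 2 * dot f (kernel_op K1 g) <= c * (s * (2 * h))%:R * (norm2 f + norm2 g).
  have -> : dot f (kernel_op K1 g) = dot (SF f) (kernel_op L (SF g)).
    rewrite !dot_kernel_op SE; apply: eq_bigr => u _.
    under [RHS]eq_bigr => v _ do rewrite /SF big_distrlr mulr_sumr.
    rewrite exchange_big /=; apply: eq_bigr => w _.
    rewrite SE; apply: eq_bigr => v _; rewrite mulr_sumr.
    by apply: eq_bigr.
  have le f' : norm2 (SF f') <= (s * (2 * h))%:R * norm2 f'.
    rewrite /norm2 /dot [X in _ <= _ * X]SE mulr_sumr; apply: ler_sum => u _.
    rewrite -expr2 (le_trans (sqr_sum_le _)) //.
    by rewrite !card_prod card_bool !card_ord.
  apply: (le_trans (HL _ _ _ _)); rewrite -?SE //.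
  by rewrite -mulrA ler_pM2l // mulrDr lerD.
have H2 := regular_form_ge K2C K2d f g.
have H3 := regular_form_le KFC (fun x => filler_kernel_deg x rh) f g.
by rewrite !mulrDl; lra.
Qed.

End BlowUp.

(** * Eigenvalues of a contracting symmetric matrix *)

Section Spectrum.
Variable R : realType.

Lemma char_poly_conj (F : fieldType) n (P P' A : 'M[F]_n) :
  P' *m P = 1%:M -> char_poly (P' *m A *m P) = char_poly A.
Proof.
move=> PP; rewrite /char_poly.
have -> : char_poly_mx (P' *m A *m P) =
    map_mx polyC P' *m char_poly_mx A *m map_mx polyC P.
  rewrite /char_poly_mx mulmxBr mulmxBl -!map_mxM; congr (_ - _).
  by rewrite scalar_mxC -mulmxA -map_mxM PP map_mx1 mulmx1.
rewrite !det_mulmx mulrAC -det_mulmx -map_mxM PP map_mx1 det1 mul1r //.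
Qed.

Lemma Re_sum (I : finType) (F : I -> R[i]) :
  complex.Re (\sum_i F i) = \sum_i complex.Re (F i).
Proof. by apply: (big_morph (@complex.Re R)) => // -[? ?] []. Qed.

Lemma Im_sum (I : finType) (F : I -> R[i]) :
  complex.Im (\sum_i F i) = \sum_i complex.Im (F i).
Proof. by apply: (big_morph (@complex.Im R)) => // -[? ?] []. Qed.

(** Separating real and imaginary parts [x], [y] of the eigenvector, the
    symmetry of [A] makes the imaginary part of [z] times the squared norm of
    [v] vanish.  Then [x] and [y] are themselves eigenvectors of sum zero, to
    which the contraction bound applies. *)
Lemma symmetric_eigenvalue n (A : 'M[R]_n) (c : R) (z : R[i]) (v : 'rV[R[i]]_n) :
  0 <= c -> A^T = A ->
  (forall x : 'rV[R]_n, \sum_j x 0 j = 0 ->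
     \sum_j (x *m A) 0 j ^+ 2 <= c ^+ 2 * \sum_j x 0 j ^+ 2) ->
  v != 0 -> \sum_j v 0 j = 0 -> v *m map_mx (real_complex R) A = z *: v ->
  z = (complex.Re z)%:C%C /\ `|complex.Re z| <= c.
Proof.
move=> c0 AT HA v0 sv Hv.
pose x := map_mx (@complex.Re R) v; pose y := map_mx (@complex.Im R) v.
pose a := complex.Re z; pose b := complex.Im z.
have xA : x *m A = a *: x - b *: y.
  apply/rowP => j; have /rowP/(_ j) := Hv; rewrite !mxE => /(congr1 (@complex.Re R)).
  rewrite Re_sum /= => H; rewrite /a /b.
  transitivity (complex.Re (z * v 0 j)); last by case: (z) (v 0 j) => [? ?] [].
  rewrite -H; apply: eq_bigr => k _; rewrite !mxE.
  by case: (v 0 k) => ? ? /=; rewrite mulr0 subr0.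
have yA : y *m A = b *: x + a *: y.
  apply/rowP => j; have /rowP/(_ j) := Hv; rewrite !mxE => /(congr1 (@complex.Im R)).
  rewrite Im_sum /= => H; rewrite /a /b.
  transitivity (complex.Im (z * v 0 j)); last first.
    by case: (z) (v 0 j) => [? ?] [] ? ? /=; rewrite addrC.
  rewrite -H; apply: eq_bigr => k _; rewrite !mxE.
  by case: (v 0 k) => ? ? /=; rewrite mulr0 add0r.
have sx : \sum_j x 0 j = 0.
  have := congr1 (@complex.Re R) sv; rewrite Re_sum /= => sv'.
  by rewrite -[RHS]sv'; apply: eq_bigr => j _; rewrite mxE.
have sy : \sum_j y 0 j = 0.
  have := congr1 (@complex.Im R) sv; rewrite Im_sum /= => sv'.
  by rewrite -[RHS]sv'; apply: eq_bigr => j _; rewrite mxE.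
pose ip (u w : 'rV[R]_n) := \sum_j u 0 j * w 0 j.
have ipE (u w : 'rV[R]_n) : ip u w = (u *m w^T) 0 0.
  by rewrite mxE; apply: eq_bigr => j _; rewrite mxE.
have ipC u w : ip u w = ip w u by apply: eq_bigr => j _; rewrite mulrC.
have ipA u w : ip (u *m A) w = ip u (w *m A).
  by rewrite !ipE trmx_mul AT mulmxA.
have ipl (s t : R) u u' w : ip (s *: u + t *: u') w = s * ip u w + t * ip u' w.
  rewrite /ip !mulr_sumr -big_split; apply: eq_bigr => j _ /=.
  by rewrite !mxE; ring.
have ip_ge0 u : 0 <= ip u u.
  by apply: sumr_ge0 => j _; rewrite -expr2 sqr_ge0.
have ip_eq0 u : ip u u = 0 -> u = 0.
  move=> /eqP; rewrite psumr_eq0 => [/allP H|j _]; last by rewrite -expr2 sqr_ge0.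
  apply/rowP => j; have := H j (mem_index_enum j).
  by rewrite mulf_eq0 orbb mxE => /eqP.
have pos : 0 < ip x x + ip y y.
  rewrite lt_neqAle addr_ge0 // andbT eq_sym paddr_eq0 //.
  apply: contra_neqN v0 => /andP[/eqP/ip_eq0 x0 /eqP/ip_eq0 y0].
  apply/rowP => j; move/rowP: x0 => /(_ j); move/rowP: y0 => /(_ j).
  by rewrite !mxE; case: (v 0 j) => ? ? /= -> ->.
have b0 : b = 0.
  have := ipA x y; rewrite [ip x _]ipC xA yA -scaleNr !ipl [ip y x]ipC => H.
  apply/eqP; have : b * (ip x x + ip y y) = 0 by lra.
  by move/eqP; rewrite mulf_eq0 (gt_eqF pos) orbF.
split; first by move: b0; rewrite /b; case: (z) => ? ? /= ->.
have sq u : u *m A = a *: u -> \sum_j u 0 j = 0 -> a ^+ 2 * ip u u <= c ^+ 2 * ip u u.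
  move=> uA su; have := HA u su; rewrite uA.
  have -> : \sum_j (a *: u) 0 j ^+ 2 = a ^+ 2 * ip u u.
    by rewrite mulr_sumr; apply: eq_bigr => j _; rewrite mxE exprMn -expr2.
  by have -> : \sum_j u 0 j ^+ 2 = ip u u by [].
move: xA yA; rewrite b0 !scale0r subr0 add0r => xA yA.
have := lerD (sq _ xA sx) (sq _ yA sy).
rewrite -!mulrDr ler_pM2r // => ac.
by rewrite -/a -ler_sqr ?nnegrE // real_normK // num_real.
Qed.

(** Split off the eigenvalue [d] of the constant vector by a change of basis [P]
    whose first column is constant.  The eigenvectors of the remaining block
    lift to eigenvectors of [A] that vanish on this column, that is, of sum
    zero.  Hence the bound holds for all other eigenvalues with multiplicity,
    without any diagonalization. *)
Lemma spectrum_deflate m (A : 'M[R]_(1 + m)) (d c : R) : 0 <= c -> A^T = A ->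
  (forall i, \sum_j A i j = d) ->
  (forall x : 'rV[R]_(1 + m), \sum_j x 0 j = 0 ->
     \sum_j (x *m A) 0 j ^+ 2 <= c ^+ 2 * \sum_j x 0 j ^+ 2) ->
  exists2 s : seq R, all (fun a => `|a| <= c) s &
    char_poly A = ('X - d%:P) * \prod_(a <- s) ('X - a%:P).
Proof.
move=> c0 AT Ad HA.
pose P : 'M[R]_(1 + m) := block_mx 1%:M 0 (const_mx 1) 1%:M.
pose P' : 'M[R]_(1 + m) := block_mx 1%:M 0 (- const_mx 1) 1%:M.
have PP' : P *m P' = 1%:M.
  rewrite mulmx_block !mulmx1 !mul1mx !mul0mx !mulmx0 !addr0 add0r subrr.
  by rewrite -scalar_mx_block.
have P'P : P' *m P = 1%:M by exact: mulmx1C.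
pose B := P' *m A *m P.
have Pl : lsubmx P = const_mx 1.
  rewrite /P block_mxEh row_mxKl.
  rewrite (_ : 1%:M = const_mx 1) ?col_mx_const //.
  by apply/matrixP => i j; rewrite !mxE !ord1.
have Pcol j : P j (lshift m 0) = 1.
  have -> : P j (lshift m 0) = lsubmx P j 0 by rewrite [RHS]mxE.
  by rewrite Pl mxE.
have Bcol : lsubmx B = d *: lsubmx (1%:M : 'M[R]_(1 + m)).
  have -> : lsubmx B = P' *m (A *m lsubmx P).
    rewrite /B -[X in lsubmx (_ *m X)](hsubmxK P) mul_mx_row row_mxKl.
    by rewrite !mulmxA.
  have -> : A *m lsubmx P = d *: lsubmx P.
    apply/matrixP => i j; rewrite Pl !mxE mulr1 -[RHS](Ad i).
    by apply: eq_bigr => k _; rewrite !mxE mulr1.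
  rewrite -scalemxAr; congr (_ *: _).
  by rewrite -[P in LHS]hsubmxK in P'P *; rewrite -P'P mul_mx_row row_mxKl.
have BP' : P' *m A = B *m P' by rewrite /B -!mulmxA PP' mulmx1.
have chiB : char_poly B = char_poly A := char_poly_conj A P'P.
clearbody B; pose A' := drsubmx B.
have BE : B = block_mx d%:M (ursubmx B) 0 A'.
  rewrite -[LHS]submxK; congr block_mx.
    apply/matrixP => i j.
    have := congr1 (fun M : 'M[R]_(1 + m, 1) => M (lshift m i) j) Bcol.
    by rewrite !mxE !ord1 /= mulr1.
  apply/matrixP => i j.
  have := congr1 (fun M : 'M[R]_(1 + m, 1) => M (rshift 1 i) j) Bcol.
  by rewrite !mxE !ord1 /= mulr0.
have chi : char_poly A = ('X - d%:P) * char_poly A'.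
  rewrite -chiB BE /char_poly /char_poly_mx.
  have -> : 'X%:M = block_mx 'X%:M 0 0 'X%:M :> 'M[{poly R}]_(1 + m).
    by rewrite -scalar_mx_block.
  rewrite map_block_mx opp_block_mx add_block_mx map_mx0 oppr0 addr0 add0r.
  rewrite det_ublock; congr (_ * _).
  by rewrite det_mx11 !mxE !eqxx.
have [rs Hrs] := closed_field_poly_normal (map_poly (real_complex R) (char_poly A')).
have := monic_map (real_complex R) (char_poly_monic A').
rewrite monicE => /eqP lc; rewrite lc scale1r in Hrs.
have rsP z : z \in rs -> z = (complex.Re z)%:C%C /\ `|complex.Re z| <= c.
  move=> zrs.
  have : eigenvalue (map_mx (real_complex R) A') z.
    rewrite eigenvalue_root_char -map_char_poly Hrs root_prod_XsubC //.
  move=> /eigenvalueP[w wA w0].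
  pose v := row_mx (0 : 'M_(1, 1)) w *m map_mx (real_complex R) P'.
  have vP : v *m map_mx (real_complex R) P = row_mx 0 w.
    by rewrite -mulmxA -map_mxM P'P map_mx1 mulmx1.
  apply: (@symmetric_eigenvalue _ A c z v) => //.
  - by apply: contra_neq w0 => v0; move: vP; rewrite v0 mul0mx -row_mx0 => /eq_row_mx[].
  - have /rowP/(_ (lshift m 0)) := vP; rewrite row_mxEl !mxE => vP0.
    rewrite -[RHS]vP0; apply: eq_bigr => j _.
    by rewrite [map_mx _ _ _ _]mxE Pcol mulr1.
  have -> : v *m map_mx (real_complex R) A =
      row_mx 0 w *m map_mx (real_complex R) B *m map_mx (real_complex R) P'.
    by rewrite /v -!mulmxA -!map_mxM BP'.
  rewrite BE map_block_mx mul_row_block !mul0mx !add0r map_mx0 mulmx0 wA.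
  by rewrite /v scalemxAl scale_row_mx scaler0.
exists (map (@complex.Re R) rs).
  by apply/allP => _ /mapP[z zrs ->]; have [] := rsP z zrs.
rewrite chi; congr (_ * _); apply: (map_poly_inj (real_complex R)).
rewrite Hrs rmorph_prod big_map; apply: eq_big_seq => z zrs /=.
by rewrite map_polyXsubC; congr (_ - _%:P); exact: (rsP z zrs).1.
Qed.

Lemma spectrum_of_contraction n (A : 'M[R]_n) (d c : R) : (1 < n)%N ->
  0 <= c -> c <= d -> A^T = A ->
  (forall i, \sum_j A i j = d) ->
  (forall x : 'rV[R]_n, \sum_j x 0 j = 0 ->
     \sum_j (x *m A) 0 j ^+ 2 <= c ^+ 2 * \sum_j x 0 j ^+ 2) ->
  exists2 s : seq R, spectrum A s & Num.max `|s`_1| `|s`_n.-1| <= c.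
Proof.
case: n A => [//|m] A m0 c0 cd AT Ad HA.
have [s /allP sc chi] := @spectrum_deflate m A d c c0 AT Ad HA.
have {}chi : char_poly A = \prod_(a <- d :: s) ('X - a%:P) by rewrite big_cons.
have szs : size s = m.
  by have := size_char_poly A; rewrite chi size_prod_XsubC /= => -[].
pose t := sort >=%R s.
have memt i : (i < m)%N -> `|t`_i| <= c.
  by move=> im; apply: sc; rewrite -(mem_sort >=%R) mem_nth // size_sort szs.
have tots : total (>=%R : rel R) by move=> x y; exact: le_total.
exists (d :: t).
  split; last by rewrite chi; apply: perm_big; rewrite perm_sym perm_cons perm_sort.
  rewrite /= path_min_sorted ?sort_sorted //.
  apply/allP => a; rewrite mem_sort => /sc; rewrite ler_norml => /andP[_ ac].
  exact: le_trans cd.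
rewrite ge_max /= memt //=.
by case: m m0 memt {A AT Ad HA chi szs} => [//|k] _ ->.
Qed.

End Spectrum.

(** * Graphs with a spectral gap *)

Section GraphSpectrum.
Variables (R : realType) (G : sgraph).

Definition edge_kernel (x y : G) : nat := edge x y.

Lemma ndl_of_gap (d : nat) (c : R) : (1 < #|G|)%N -> regular G d ->
  0 < c -> c <= d%:R -> gap edge_kernel c ->
  exists2 lambda : R, ndl_graph #|G| d lambda G & lambda <= c.
Proof.
move=> G1 Gd c0 cd Hgap.
have kd x : (\sum_y edge_kernel x y = d)%N.
  rewrite -[RHS](Gd x) -sum1_card [RHS]big_mkcond.
  by apply: eq_bigr => y _; rewrite inE /edge_kernel; case: edge.
have kC x y : edge_kernel x y = edge_kernel y x by rewrite /edge_kernel edge_sym.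
have Hc : contracts (kernel_op (R := R) edge_kernel) c.
  apply: dot_contracts => // f f0.
  rewrite exchange_big /= (eq_bigr (fun y => d%:R * f y)).
    by rewrite -mulr_sumr f0 mulr0.
  move=> y _.
  by rewrite -mulr_suml -natr_sum; under eq_bigr do rewrite kC; rewrite kd.
have rei (h : G -> R) : \sum_(j < #|G|) h (enum_val j) = \sum_v h v.
  by rewrite [RHS](reindex (@enum_val G G)) //; apply: onW_bij; exact: enum_val_bij.
have AE i j : adjacency R G i j = (edge_kernel (enum_val i) (enum_val j))%:R.
  by rewrite mxE.
have [|i|x x0|s Hs sc] :=
  @spectrum_of_contraction R _ (adjacency R G) d%:R c G1 (ltW c0) cd.
- by apply/matrixP => i j; rewrite mxE !AE kC.
- under eq_bigr do rewrite AE.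
  by rewrite (rei (fun v => (edge_kernel (enum_val i) v)%:R)) -natr_sum kd.
- pose f v := x 0 (enum_rank v).
  have f0 : \sum_v f v = 0.
    by rewrite -rei -[RHS]x0; apply: eq_bigr => j _; rewrite /f enum_valK.
  have := Hc f f0; rewrite /norm2 /dot -!rei.
  have -> : \sum_(j < #|G|) f (enum_val j) * f (enum_val j) = \sum_j x 0 j ^+ 2.
    by apply: eq_bigr => j _; rewrite /f enum_valK expr2.
  apply: le_trans; rewrite le_eqVlt; apply/orP; left; apply/eqP.
  apply: eq_bigr => j _; rewrite -expr2; congr (_ ^+ 2).
  rewrite mxE /kernel_op -rei; apply: eq_bigr => i _.
  by rewrite AE /f enum_valK mulrC kC.
exists (Num.max `|s`_1| `|s`_#|G|.-1|) => //.
by split=> //; exists s.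
Qed.

End GraphSpectrum.

(** * Induced paths *)

Section InducedPaths.
Variable G : sgraph.

Lemma induced_pathP l : has_induced_path G l ->
  exists2 g : 'I_l.+1 -> G, injective g &
    forall i j, edge (g i) (g j) = path_edge i j.
Proof.
move=> [S [f [/bij_inj fI fE]]]; exists (fun i => val (f i)).
  by move=> i j /val_inj/fI.
by move=> i j; exact: (fE i j).
Qed.

Lemma trivial_induced_path (x : G) : has_induced_path G 0.
Proof.
exists [set x]%SET; exists (fun _ => exist _ x (set11 x)); split.
  exists (fun _ => ord0) => [i|[y yx]]; first by rewrite [LHS]ord1 [RHS]ord1.
  by apply: val_inj => /=; move: (yx); rewrite inE => /eqP.
by move=> i j; rewrite (ord1 i) (ord1 j) !edge_irr.
Qed.

Lemma longest_induced_path_exists (x : G) N :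
  (forall m, has_induced_path G m -> (m <= N)%N) ->
  exists2 l, longest_induced_path_length G l & (l <= N)%N.
Proof.
move=> HN; pose P m := `[< has_induced_path G m >].
have P0 : exists m, P m by exists 0%N; apply/asboolP; exact: trivial_induced_path x.
have PN m : P m -> (m <= N)%N by move=> /asboolP/HN.
have [l /asboolP Hl lmax] := ex_maxnP P0 PN.
by exists l; [split=> // m Hm; apply: lmax; apply/asboolP | exact: HN].
Qed.

Lemma path_closed_full l (I : {set 'I_l.+1}) i0 : i0 \in I ->
  (forall i j, i \in I -> path_edge i j -> j \in I) -> forall j, j \in I.
Proof.
move=> i0I HI.
have up k (j : 'I_l.+1) : (j = i0 + k :> nat)%N -> j \in I.
  elim: k j => [|k IH] j jk.
    by rewrite (_ : j = i0) //; apply: val_inj; rewrite /= jk addn0.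
  have kl : (i0 + k < l.+1)%N by have := ltn_ord j; lia.
  apply: (HI (Ordinal kl)); first exact: IH.
  by rewrite /path_edge /= jk addnS eqxx.
have down k (j : 'I_l.+1) : (j + k = i0 :> nat)%N -> j \in I.
  elim: k j => [|k IH] j jk.
    by rewrite (_ : j = i0) //; apply: val_inj; rewrite /= -jk addn0.
  have kl : (j.+1 < l.+1)%N by have := ltn_ord i0; lia.
  apply: (HI (Ordinal kl)); first by apply: IH; rewrite /= -jk; lia.
  by rewrite /path_edge /= eqxx orbT.
move=> j; have [ji|/ltnW ij] := leqP j i0.
  by apply: (down (i0 - j)%N); rewrite subnKC.
by apply: (up (j - i0)%N); rewrite subnKC.
Qed.

(** A vertex cannot distinguish the members of a blob to which it does not
    belong.  If an induced path meets a blob three times, no vertex of the path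
    outside the blob can be adjacent to a vertex of the path inside it, since
    it would have three neighbours on the path; being connected, the path then
    stays inside the blob.  Otherwise it meets each blob at most twice. *)
Lemma blob_path_bound (B : finType) (blob : G -> B) m l :
  (forall x x' y, blob x = blob x' -> blob y != blob x -> edge x y = edge x' y) ->
  (forall b, (#|[set x | blob x == b]%SET| <= m)%N) ->
  has_induced_path G l -> (l.+1 <= maxn (2 * #|B|) m)%N.
Proof.
move=> twin Bm /induced_pathP[g gI gE]; rewrite leq_max.
pose I b := [set i | blob (g i) == b]%SET.
have [/forallP small|] := boolP [forall b, #|I b| <= 2]%N.
  apply/orP; left.
  rewrite -[X in (X <= _)%N]card_ord -sum1_card.
  rewrite (partition_big (blob \o g) predT) //= mulnC -sum_nat_const.
  apply: leq_sum => b _; rewrite sum1_card; apply: leq_trans (small b).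
  by apply: subset_leq_card; apply/fintype.subsetP => i; rewrite !inE.
rewrite negb_forall => /existsP[b]; rewrite -ltnNge.
move=> /card_gt2P[i1 [i2 [i3 [[h1 h2 h3] [n12 n23 n31]]]]].
apply/orP; right; apply: leq_trans (Bm b).
have full : forall j, j \in I b.
  apply: (path_closed_full h1) => i j iI ij; apply: contraT => jI.
  have nb i' : i' \in I b -> path_edge i' j.
    move: iI jI; rewrite !inE => /eqP bi bj /eqP bi'.
    by rewrite -gE (twin _ (g i)) ?gE ?bi ?bi'.
  move: (nb _ h1) (nb _ h2) (nb _ h3) n12 n23 n31.
  by rewrite /path_edge -!val_eqE /=; lia.
rewrite -[X in (X <= _)%N]card_ord -(card_imset _ gI); apply: subset_leq_card.
apply/fintype.subsetP => _ /imsetP[i _ ->]; have := full i; rewrite !inE //.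
Qed.

End InducedPaths.

Lemma blowup_path_bound (U : finType) (L : rel U) (s h r : nat)
    (LC : symmetric L) l :
  has_induced_path (blowup s h r LC) l -> (l.+1 <= maxn (2 * (#|U| * s)) (2 * h))%N.
Proof.
have -> : (#|U| * s)%N = #|{: U * 'I_s}| by rewrite card_prod card_ord.
apply: (@blob_path_bound (blowup s h r LC) _ (fun x => x.1)) => [x x' y xx' yx|b].
  have xy : (x.1 == y.1) = false by rewrite eq_sym (negPf yx).
  by rewrite /= /blowup_edge -xx' xy.
rewrite (_ : [set x | _]%SET = [set (b, z) | z in [set: bool * 'I_h]]%SET).
  by rewrite card_imset ?cardsT ?card_prod ?card_bool ?card_ord // => z z' [].
apply/setP => -[p z]; rewrite !inE /=.
apply/eqP/imsetP => [->|[z' _ [-> _]] //]; by exists z; rewrite ?inE.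
Qed.

(** * The theorem *)

Lemma unbounded_infinite (A : set nat) :
  (forall N, exists2 n, (N < n)%N & A n) -> infinite_set A.
Proof.
move=> HA /finite_seqP[s As].
have [n ns An] := HA (\max_(i <- s) i)%N.
have : n \in s by move: An; rewrite As.
move=> ins; have := @leq_bigmax_seq _ s predT (fun i => i) n ins isT.
by rewrite leqNgt ns.
Qed.

Theorem theorem3 (R : realType) (delta : R) (delta_gt0 : 0 < delta) :
  exists2 C : R, 0 < C &
  exists d1 : nat, forall d : nat, (d1 <= d)%N ->
  infinite_set (fun n : nat =>
    exists (G : sgraph) (lambda : R) (l : nat),
      [/\ ndl_graph n d lambda G,
          lambda / d%:R <= delta,
          longest_induced_path_length G l &
          l%:R <= C * n%:R / d%:R]).
Proof.
(* The three terms of [blowup_gap] cost [2 * e], [e] and [e] times [d].  Capping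
   at 1 keeps the bound below [d], as the ordering of the spectrum requires. *)
pose e := Num.min delta 1 / 4.
have m0 : 0 < Num.min delta 1 by rewrite lt_min delta_gt0 ltr01.
have e0 : 0 < e by rewrite divr_gt0.
have [d0 d00 Hfam] := simple_expander_family e0.
pose t := (Num.bound e^-1).+1.
have te : 1 <= e * t%:R.
  rewrite mulrC -ler_pdivrMr // div1r ltW //.
  apply: (lt_le_trans (archi_boundP _)); first by rewrite invr_ge0 ltW.
  by rewrite ler_nat.
(* The degree contributed by a blob size of 2; [d] is then divided by [c0]. *)
pose c0 := (d0 * t * 2)%N.
have c00 : (0 < c0)%N by rewrite !muln_gt0 d00.
exists (2 * c0)%:R; first by rewrite ltr0n muln_gt0.
(* The first bound ensures that the remainder [r] fits into a blob, the second
   one that [r] is negligible against [d]. *)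
exists (maxn (c0 ^ 2) (Num.bound (c0%:R / e : R))).
move=> d; rewrite geq_max => /andP[dc0 dce].
pose h := (d %/ c0)%N; pose r := (d %% c0)%N.
have dE : d = (d0 * t * (2 * h) + r)%N.
  by rewrite {1}(divn_eq d c0) /h /r /c0; lia.
have rc : (r < c0)%N by rewrite ltn_pmod.
have hc : (c0 <= h)%N by rewrite leq_divRL // mulnn.
have rh : (r <= h)%N by rewrite ltnW // (leq_trans rc).
have h0 : (0 < h)%N by exact: leq_trans hc.
have d_gt0 : (0 < d)%N by rewrite (leq_trans _ dc0) // expn_gt0 c00.
have d0R : 0 < d%:R :> R by rewrite ltr0n.
apply: unbounded_infinite => N.
(* With at least [h] base vertices, a path inside one blob is short as well. *)
have [U NU [L [LC Ld HL]]] := Hfam (maxn N.+1 h).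
move: NU; rewrite geq_max => /andP[NU hU].
pose G := blowup t.+1 h r LC.
have U0 : (0 < #|U|)%N by exact: leq_trans NU.
have cG : #|G| = (#|U| * t.+1 * (2 * h))%N by exact: card_blowup.
have UG : (#|U| < #|G|)%N by rewrite cG; nia.
exists #|G|; first by rewrite (leq_trans NU) // ltnW.
have Gd : regular G d by rewrite dE; exact: blowup_regular.
pose c : R := e * d0%:R * (t.+1 * (2 * h))%:R + (d0 * (2 * h))%:R + r%:R.
have c_gt0 : 0 < c.
  rewrite /c -addrA ltr_pwDl ?addr_ge0 ?ler0n //.
  by apply: mulr_gt0; [apply: mulr_gt0 => //|]; rewrite ltr0n ?muln_gt0.
have cle : c <= 4 * e * d%:R.
  have re : r%:R <= e * d%:R.
    have : c0%:R / e <= d%:R.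
      apply: ltW; apply: (lt_le_trans (archi_boundP _)); last by rewrite ler_nat.
      by rewrite divr_ge0 ?ler0n // ltW.
    rewrite ler_pdivrMr // mulrC; apply: le_trans.
    by rewrite ler_nat ltnW.
  pose a : R := (d0 * (2 * h))%:R.
  have a0 : 0 <= a by rewrite ler0n.
  have dR : d%:R = a * t%:R + r%:R.
    by rewrite {1}dE natrD /a -natrM; congr (_%:R + _); lia.
  have cE : c = e * a * t.+1%:R + a + r%:R.
    by rewrite /c /a !natrM; ring.
  have t1 : 1 <= t%:R :> R by rewrite ler1n.
  have H1 : a <= e * t%:R * a by rewrite ler_peMl.
  have H2 : e * a <= e * a * t%:R by rewrite ler_peMr // mulr_ge0 // ltW.
  have r0 : 0 <= e * r%:R by rewrite mulr_ge0 ?ler0n // ltW.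
  rewrite cE -[t.+1]addn1 natrD.
  have dRe : e * d%:R = e * (a * t%:R + r%:R) by rewrite dR.
  lra.
have e4 : 4 * e = Num.min delta 1 by rewrite /e mulrC divfK ?pnatr_eq0.
have cd : c <= d%:R.
  by apply: (le_trans cle); rewrite e4 ger_pMl // ge_min lexx orbT.
have Ggap : gap (@edge_kernel G) c.
  by apply: blowup_gap => //; rewrite mulr_gt0 ?ltr0n.
have [lambda Glam lamc] := ndl_of_gap (leq_ltn_trans U0 UG) Gd c_gt0 cd Ggap.
have /card_gt0P[x _] : (0 < #|G|)%N by exact: leq_ltn_trans UG.
have bound m : has_induced_path G m -> (m <= 2 * (#|U| * t.+1))%N.
  move=> /blowup_path_bound /ltnW /leq_trans; apply.
  by rewrite geq_max leqnn /= leq_mul2l /= (leq_trans hU) // leq_pmulr.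
have [l Gl lU] := longest_induced_path_exists x bound.
exists G, lambda, l; split=> //.
  rewrite ler_pdivrMr // (le_trans lamc) // (le_trans cle) // ler_wpM2r ?ler0n //.
  by rewrite e4 ge_min lexx.
rewrite ler_pdivlMr // -!natrM ler_nat cG.
have d2 : (d <= 2 * c0 * h)%N.
  by rewrite (divn_eq d c0) -/h -/r; nia.
apply: (leq_trans (leq_mul lU d2)); lia.
Qed.
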